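(* Every linear topology on $\mathbb{D}=\mathbb{D}([0,T])$ which is coarser than $mJ_1$ is coarser than the $S$ topology as well. That is, if $\sigma$ is a topology on $\mathbb{D}$ such that $(\mathbb{D},\sigma)$ is a linear topological space and every $\sigma$-open set is $mJ_1$-open, then every $\sigma$-open set is $S$-open.
   Context: Fix $0<T<\infty$. $\mathbb{D}=\mathbb{D}([0,T])$ is the set of functions $x:[0,T]\to\mathbb{R}$ which are right-continuous at every $t\in[0,T)$ and have left limits at every $t\in(0,T]$; for other compact intervals $[a,b]$, $\mathbb{D}([a,b])$ is defined analogously. $\|x\|_\infty=\sup_{t\in[0,T]}|x(t)|$. The total variation is $\|v\|(T)=\sup\{|v(0)|+\sum_{i=1}^m|v(t_i)-v(t_{i-1})|\}$, the supremum being over all $0=t_0<t_1<\dots<t_m=T$, $m\in\mathbb{N}$, and $\mathbb{V}=\{x\in\mathbb{D}:\|x\|(T)<\infty\}$. For $v_n,v_0\in\mathbb{V}$, $v_n\Rightarrow v_0$ means $\int_{[0,T]}f\,dv_n\to\int_{[0,T]}f\,dv_0$ for every continuous $f:[0,T]\to\mathbb{R}$, where the signed measure $dv$ on $[0,T]$ is determined by $dv([0,t])=v(t)$ (in particular it has mass $v(0)$ at $0$). S-convergence: $x_n\longrightarrow_S x_0$ if for every $\varepsilon>0$ there are $v_{n,\varepsilon}\in\mathbb{V}$, $n=0,1,2,\dots$, with $\|x_n-v_{n,\varepsilon}\|_\infty\le\varepsilon$ for all $n\ge0$ and $v_{n,\varepsilon}\Rightarrow v_{0,\varepsilon}$ as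 $n\to\infty$. The $S$ topology on $\mathbb{D}$ is the sequential topology generated by $\longrightarrow_S$: a set $F\subset\mathbb{D}$ is closed iff $x_n\in F$ for $n\ge 1$ and $x_n\longrightarrow_S x_0$ imply $x_0\in F$. The $mJ_1$ topology: fix $\varepsilon>0$ and for $x\in\mathbb{D}([0,T])$ define $\widetilde{x}\in\mathbb{D}([-\varepsilon,T+\varepsilon])$ by $\widetilde{x}(t)=0$ if $-\varepsilon\le t<0$, $\widetilde{x}(t)=x(t)$ if $0\le t<T$, $\widetilde{x}(t)=x(T)$ if $T\le t\le T+\varepsilon$. Let $d_{Sk}$ be Billingsley's complete metric for the Skorokhod $J_1$ topology on $\mathbb{D}([-\varepsilon,T+\varepsilon])$, i.e. $d_{Sk}(y,z)=\inf_\lambda\max\{\sup_{s<t}|\log\frac{\lambda(t)-\lambda(s)}{t-s}|,\ \sup_t|y(t)-z(\lambda(t))|\}$, the infimum being over increasing homeomorphisms $\lambda$ of $[-\varepsilon,T+\varepsilon]$ onto itself. Then $mJ_1$ is the topology on $\mathbb{D}([0,T])$ of the metric $d(x,y)=d_{Sk}(\widetilde{x},\widetilde{y})$. A topology $\sigma$ is linear if addition and scalar multiplication are (jointly) continuous. ''Coarser'' is meant in the non-strict sense. *)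

(* Defs.v *)
From HB Require Import structures.
From mathcomp Require Import all_boot all_order all_algebra.
From mathcomp Require Import all_classical all_reals all_analysis.

Set Implicit Arguments.
Unset Strict Implicit.
Unset Printing Implicit Defensive.

Import Order.TTheory GRing.Theory Num.Theory.
Import numFieldNormedType.Exports.

Local Open Scope classical_set_scope.
Local Open Scope ring_scope.

Section cadlag_functions.
Context {R : realType}.
Implicit Types (a b : R) (f : R -> R).

Definition cadlag a b f :=
  (forall t, a <= t < b -> f x @[x --> t^'+] --> f t) /\
  (forall t, a < t <= b -> cvg (f x @[x --> t^'-])).

(* A function on [a, b] is encoded by its extension by 0 to the whole line, so
   that equality in D([a, b]) is equality of functions. *)
Definition Dpred a b : {pred R -> R} :=
  [pred f | `[< cadlag a b f /\ (forall t, ~~ (a <= t <= b) -> f t = 0) >]].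

Lemma DpredP a b f :
  reflect (cadlag a b f /\ (forall t, ~~ (a <= t <= b) -> f t = 0))
          (f \in Dpred a b).
Proof. by rewrite -topredE; exact: asboolP. Qed.

Lemma cadlag_lin a b (k : R) f g :
  cadlag a b f -> cadlag a b g -> cadlag a b (k *: f + g).
Proof.
move=> [fr fl] [gr gl]; split=> t tab.
  by apply: cvgD; [apply: cvgZr; exact: fr|exact: gr].
by apply: is_cvgD; [apply: is_cvgZr; exact: fl|exact: gl].
Qed.

Lemma Dpred_submod_closed a b : submod_closed (Dpred a b).
Proof.
split=> [|k f g].
  apply/DpredP; split=> //; split=> t _.
    exact: (@cvg_cst R^o).
  exact: (@is_cvg_cst R^o).
move=> /DpredP[cf f0] /DpredP[cg g0]; apply/DpredP; split.
  exact: cadlag_lin.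
move=> t tab; rewrite /GRing.add /GRing.scale/= f0// g0//.
by rewrite scaler0 addr0.
Qed.

HB.instance Definition _ a b :=
  GRing.isSubmodClosed.Build R (R -> R) (Dpred a b) (Dpred_submod_closed a b).

Record D a b := MkD { Dval :> R -> R; _ : Dval \in Dpred a b }.

HB.instance Definition _ a b := [isSub for @Dval a b].
HB.instance Definition _ a b := [Choice of D a b by <:].
HB.instance Definition _ a b := [SubChoice_isSubLmodule of D a b by <:].

Definition supnorm a b f : \bar R :=
  ereal_sup [set `|f t|%:E | t in `[a, b]].

End cadlag_functions.
Arguments D {R} a b.

Section linear_topology.
Context {R : realType} {E : lmodType R}.

(* No separation axiom is required. *)
Definition linear_topology (tau : Topological E) :=
  let Et := Topological.Pack tau in
  continuous (fun z : Et * Et => ((z.1 : E) + (z.2 : E)) : Et) /\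
  continuous (fun z : R^o * Et => (z.1 *: (z.2 : E)) : Et).

End linear_topology.

Definition coarser {E : Type} (tau1 tau2 : Topological E) :=
  forall U : set E,
    @open (Topological.Pack tau1) U -> @open (Topological.Pack tau2) U.

Section charge_integral.
Context d (X : measurableType d) (R : realType).

(* The value does not depend on the Hahn decomposition chosen by [cid]. *)
Definition charge_integral (nu : {charge set X -> \bar R}) (A : set X)
    (f : X -> R) : R :=
  let P := cid (Hahn_decomposition nu) in
  let N := cid (svalP P) in
  \int[jordan_pos (svalP N)]_(x in A) f x -
  \int[jordan_neg (svalP N)]_(x in A) f x.

End charge_integral.

Section S_topology.
Context {R : realType}.
Variable T : R.

Definition tvnorm (v : R -> R) : \bar R :=
  ereal_sup [set (`|v 0| + variation 0 T v s)%:E | s in itv_partition 0 T].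

Definition inV (v : D 0 T) := (tvnorm v < +oo)%E.

(* Only the trace on [0, T] of the signed measure nu is determined by v, and
   only this trace is used. *)
Definition is_dv (v : D 0 T) (nu : {charge set (measurableTypeR R) -> \bar R}) :=
  forall t, 0 <= t <= T -> nu `[0, t]%classic = (v t)%:E.

(* On [0, T] the measure dv exists and is unique when v has bounded variation,
   so that it does not matter that the measures are existentially quantified. *)
Definition Vconv (v : nat -> D 0 T) (v0 : D 0 T) :=
  exists (nu : nat -> {charge set (measurableTypeR R) -> \bar R})
    (nu0 : {charge set (measurableTypeR R) -> \bar R}),
  [/\ forall n, is_dv (v n) (nu n), is_dv v0 nu0 &
      forall f : R -> R, {within `[0, T], continuous f} ->
        charge_integral (nu n) `[0, T]%classic f @[n --> \oo]
          --> charge_integral nu0 `[0, T]%classic f].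

Definition Sconv (x : nat -> D 0 T) (x0 : D 0 T) :=
  forall e : R, 0 < e ->
  exists (v : nat -> D 0 T) (v0 : D 0 T),
  [/\ (forall n, inV (v n)) /\ inV v0,
      forall n, (supnorm 0 T (x n - v n)%R <= e%:E)%E,
      (supnorm 0 T (x0 - v0)%R <= e%:E)%E &
      Vconv v v0].

Definition Sclosed (F : set (D 0 T)) :=
  forall (x : nat -> D 0 T) (x0 : D 0 T),
    (forall n, F (x n)) -> Sconv x x0 -> F x0.

Definition Sopen (U : set (D 0 T)) := Sclosed (~` U).

Lemma Sconv_sub (phi : nat -> nat) x x0 : (forall n, (n <= phi n)%N) ->
  Sconv x x0 -> Sconv (x \o phi) x0.
Proof.
move=> phin xx0 e e0; have [v [v0 [[Vv Vv0] xv xv0]]] := xx0 e e0.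
move=> [nu [nu0 [vnu vnu0 cvnu]]].
exists (v \o phi), v0; split=> // [|n|]; first by split=> // n; exact: Vv.
  exact: xv.
exists (nu \o phi), nu0; split=> // [n|f cf]; first exact: vnu.
apply: cvg_comp (cvnu f cf) => A [n _ nA].
by exists n => // m /= nm; apply: nA; rewrite /= (leq_trans nm).
Qed.

Lemma SopenT : Sopen setT.
Proof. by move=> x x0 /(_ 0%N). Qed.

Lemma SopenI : setI_closed Sopen.
Proof.
move=> U V oU oV x x0 xUV xx0 [Ux0 Vx0].
have [[N NV]|H] := pselect (exists N, forall n, (N <= n)%N -> ~ V (x n)).
  apply: oV Vx0; last first.
    by apply: (Sconv_sub (phi := addn N)) xx0 => n; exact: leq_addl.
  by move=> n; apply: NV; exact: leq_addr.
have /choice[phi phiP] : forall N, exists n, (N <= n)%N /\ V (x n).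
  by move=> N; apply: contrapT => h; apply: H; exists N => n Nn Vn; apply: h; exists n.
apply: oU Ux0; last first.
  by apply: (Sconv_sub (phi := phi)) xx0 => n; have [] := phiP n.
by move=> n Un; apply: (xUV (phi n)); split => //; have [] := phiP n.
Qed.

Lemma Sopen_bigU (I : Type) (f : I -> set (D 0 T)) :
  (forall i, Sopen (f i)) -> Sopen (\bigcup_i f i).
Proof.
move=> of_ x x0 xf xx0 [i _ fx0]; apply: of_ xx0 fx0 => n fxn.
by apply: (xf n); exists i.
Qed.

Definition S_space : Type := D 0 T.
HB.instance Definition _ := Choice.on S_space.
HB.instance Definition _ :=
  isOpenTopological.Build S_space SopenT SopenI Sopen_bigU.

Definition S_topology : Topological (D 0 T) := Topological.on S_space.

Lemma S_openE : @open (Topological.Pack S_topology) = Sopen. Proof. by []. Qed.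

End S_topology.

Section mJ1_topology.
Context {R : realType}.

Definition increasing_homeo (a b : R) (l : R -> R) :=
  {in `[a, b] &, {homo l : s t / s < t}} /\
  exists g : R -> R,
    [/\ set_fun `[a, b] `[a, b] l, set_fun `[a, b] `[a, b] g,
        {in `[a, b], cancel l g} & {in `[a, b], cancel g l}] /\
    {within `[a, b], continuous l} /\ {within `[a, b], continuous g}.

Definition log_slope (a b : R) (l : R -> R) : \bar R :=
  ereal_sup [set `|ln ((l st.2 - l st.1) / (st.2 - st.1))|%:E |
    st in [set st : R * R | [/\ a <= st.1, st.1 < st.2 & st.2 <= b]]].

Definition dSk (a b : R) (y z : R -> R) : \bar R :=
  ereal_inf [set maxe (log_slope a b l) (supnorm a b (fun t => y t - z (l t))) |
    l in increasing_homeo a b].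

Variables T eps : R.

Definition ext (x : R -> R) (t : R) : R :=
  if t < 0 then 0 else if t < T then x t else x T.

Definition mJ1_dist (x y : D 0 T) : \bar R :=
  dSk (- eps) (T + eps) (ext x) (ext y).

Definition mJ1_open (U : set (D 0 T)) :=
  forall x, U x ->
    exists2 r : R, 0 < r & forall y, (mJ1_dist x y < r%:E)%E -> U y.

Lemma mJ1_openT : mJ1_open setT.
Proof. by move=> x _; exists 1. Qed.

Lemma mJ1_openI : setI_closed mJ1_open.
Proof.
move=> U V oU oV x [Ux Vx].
have [r r0 rU] := oU x Ux; have [s s0 sV] := oV x Vx.
exists (Num.min r s); first by rewrite lt_min r0.
by move=> y; rewrite EFin_min lt_min => /andP[/rU ? /sV].
Qed.

Lemma mJ1_open_bigU (I : Type) (f : I -> set (D 0 T)) :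
  (forall i, mJ1_open (f i)) -> mJ1_open (\bigcup_i f i).
Proof.
move=> fo x [i _ fix_]; have [r r0 rf] := fo i x fix_.
by exists r => // y /rf fy; exists i.
Qed.

Definition mJ1_space : Type := D 0 T.
HB.instance Definition _ := Choice.on mJ1_space.
HB.instance Definition _ :=
  isOpenTopological.Build mJ1_space mJ1_openT mJ1_openI mJ1_open_bigU.

Definition mJ1_topology : Topological (D 0 T) := Topological.on mJ1_space.

Lemma mJ1_openE : @open (Topological.Pack mJ1_topology) = mJ1_open. Proof. by []. Qed.

Lemma ext_cadlag (x : D 0 T) : 0 < T -> 0 < eps ->
  cadlag (- eps) (T + eps) (ext x).
Proof.
move=> T0 e0; case: x => x /= /DpredP[[xr xl] _].
split=> t /andP[t1 t2].
- have [t_lt0|t_ge0] := ltP t 0.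
    have -> : ext x t = 0 by rewrite /ext t_lt0.
    apply: cvg_near_cst; near=> s; rewrite /ext.
    by case: ifPn => // /negP; case; near: s; exact: nbhs_right_lt.
  have [tT|Tt] := ltP t T.
    have -> : ext x t = x t by rewrite /ext tT ltNge t_ge0.
    apply: cvg_trans (xr t _); last by rewrite t_ge0.
    apply: near_eq_cvg; near=> s; rewrite /ext.
    have ts : t < s by near: s; exact: nbhs_right_gt.
    have sT : s < T by near: s; exact: nbhs_right_lt.
    by rewrite ltNge (le_trans t_ge0 (ltW ts))/= sT.
  have -> : ext x t = x T by rewrite /ext !ltNge t_ge0 Tt.
  apply: cvg_near_cst; near=> s; rewrite /ext.
  have ts : t < s by near: s; exact: nbhs_right_gt.
  by rewrite !ltNge (le_trans t_ge0 (ltW ts))/= (le_trans Tt (ltW ts)).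
- have [t_le0|t_gt0] := leP t 0.
    apply/cvg_ex; exists 0; apply: cvg_near_cst; near=> s; rewrite /ext.
    have st : s < t by near: s; exact: nbhs_left_lt.
    by rewrite (lt_le_trans st t_le0).
  have [tT|Tt] := leP t T.
    have /cvg_ex[l xtl] : cvg (x s @[s --> t^'-]) by apply: xl; rewrite t_gt0.
    apply/cvg_ex; exists l; apply: cvg_trans xtl.
    apply: near_eq_cvg; near=> s; rewrite /ext.
    have s0 : 0 < s by near: s; exact: nbhs_left_gt.
    have st : s < t by near: s; exact: nbhs_left_lt.
    by rewrite ltNge (ltW s0)/= (lt_le_trans st tT).
  apply/cvg_ex; exists (x T); apply: cvg_near_cst; near=> s; rewrite /ext.
  have Ts : T < s by near: s; exact: nbhs_left_gt.
  by rewrite !ltNge (ltW Ts) (le_trans (ltW T0) (ltW Ts)).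
Unshelve. all: by end_near.
Qed.

End mJ1_topology.

(* Main.v *)
Require Import Defs.
From HB Require Import structures.
From mathcomp Require Import all_boot all_order all_algebra.
From mathcomp Require Import all_classical all_reals all_analysis.
From mathcomp Require Import ring lra.

(* If x_n --> x0 for S, then up to a uniformly small error x_n - x0 is
   u_n = v_n - v0 with du_n converging weakly to 0. By uniform boundedness the
   total variations of the u_n are bounded by some K, so stopping at the
   successive oscillations of size r puts u_n within r of a step function whose
   number and size of jumps are bounded independently of n. Jump times and sizes
   converge along an ultrafilter, to a step function y. Since s |-> 1_[s, T] is
   continuous for mJ1, the step functions converge to y in every linear topology
   coarser than mJ1; and weak convergence to 0, tested against ramp functions,
   forces |y| <= r. So u_n is, up to a uniformly small error, a sequence
   converging to 0, and uniform balls are mJ1-neighbourhoods. *)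

Set Implicit Arguments.
Unset Strict Implicit.
Unset Printing Implicit Defensive.

Import Order.TTheory GRing.Theory Num.Theory.
Import numFieldNormedType.Exports.

Local Open Scope classical_set_scope.
Local Open Scope ring_scope.

(** * Functionals representing a function of bounded variation *)

Section representing_functional.
Context {R : realType} (T : R).
Implicit Types (f g u : R -> R) (L : (R -> R) -> R).

Definition bounded_measurable f :=
  measurable_fun `[0, T]%classic f /\
  exists c : R, forall t : R, 0 <= t <= T -> `|f t| <= c.

(** Stands for [f |-> \int f du] over [[0, T]] without mentioning a measure. The test functions
    include indicators as well as continuous functions, and [Num.min t T] appears because []-oo, t]]
    is only seen through its trace on [[0, T]]. *)
Record represents u L : Prop := {
  represents_lin : forall (a : R) f g, bounded_measurable f -> bounded_measurable g ->
    L (fun t => a * f t + g t) = a * L f + L g;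
  represents_bound : exists M : R, forall f (c : R), bounded_measurable f ->
    (forall t : R, 0 <= t <= T -> `|f t| <= c) -> `|L f| <= M * c;
  represents_indic : forall t : R, 0 <= t ->
    L (fun s => (s <= t)%R%:R) = u (Num.min t T) }.

Lemma representsB u v L L' : represents u L -> represents v L' ->
  represents (fun t => u t - v t) (fun f => L f - L' f).
Proof.
move=> [Llin [M LM] Lu] [L'lin [M' LM'] L'v]; split.
- by move=> a f g bf bg; rewrite Llin// L'lin//; ring.
- exists (M + M') => f c bf fc; rewrite mulrDl (le_trans (ler_normB _ _))//.
  by rewrite lerD// ?LM// LM'.
- by move=> t t0; rewrite Lu// L'v.
Qed.

Lemma eq_represents u v L : 0 <= T -> (forall t : R, 0 <= t <= T -> u t = v t) ->
  represents u L -> represents v L.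
Proof.
move=> T0 uv [Llin LM Lu]; split=> // t t0; rewrite Lu// uv//.
by rewrite le_min t0 T0 ge_min lexx orbT.
Qed.

Lemma bounded_measurable_continuous f c : continuous f ->
  (forall t : R, 0 <= t <= T -> `|f t| <= c) -> bounded_measurable f.
Proof.
move=> cf fc; split; last by exists c.
apply: measurable_funTS.
exact: measurable_realfun.continuous_measurable_fun.
Qed.

Lemma bounded_measurable_lin a f g : bounded_measurable f ->
  bounded_measurable g -> bounded_measurable (fun t => a * f t + g t).
Proof.
move=> [mf [c fc]] [mg [c' gc]]; split.
  by apply: measurable_realfun.measurable_funD => //; exact: measurable_realfun.measurable_funM.
exists (`|a| * c + c') => t t0T.
by rewrite (le_trans (ler_normD _ _))// lerD// ?gc// normrM ler_wpM2l// fc.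
Qed.

Lemma bounded_measurable_indic t : bounded_measurable (fun s => (s <= t)%R%:R).
Proof.
split.
  have -> : (fun s : R => (s <= t)%R%:R) = \1_(`]-oo, t]%classic) :> (R -> R).
    by apply/funext => s; rewrite indicE mem_setE in_itv.
  exact: measurable_funTS.
by exists 1 => s _; case: (s <= t); rewrite ?normr1 ?normr0.
Qed.

Lemma finite_measure_represents
    (mu : {finite_measure set (measurableTypeR R) -> \bar R}) :
  represents (fun t => fine (mu `[0, t]%classic))
             (fun f => \int[mu]_(x in `[0, T]%classic) f x).
Proof.
have mI : measurable (`[0, T]%classic : set (measurableTypeR R)) by [].
have bint f : bounded_measurable f ->
    mu.-integrable `[0, T]%classic (EFin \o f).
  move=> [mf [c fc]]; apply: measurable_bounded_integrable => //.
    by rewrite ltey_eq fin_num_measure.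
  exists c; split; first exact: num_real.
  move=> x cx y /= y0T; rewrite (le_trans _ (ltW cx))// fc//.
split.
- move=> a f g bf bg; have [intf intg] := (bint f bf, bint g bg).
  rewrite RintegralD//; first by rewrite RintegralZl.
  by have := integrableZl mI a intf.
- exists (fine (mu `[0, T]%classic)) => f c bf fc.
  rewrite (le_trans (le_normr_Rintegral _ _))//; first exact: bint.
  rewrite mulrC -Rintegral_cst//; apply: le_Rintegral => //.
  + by have := integrable_norm (bint f bf).
  + have /bint// : bounded_measurable (cst c).
    by split; [exact: measurable_cst|exists `|c|].
- move=> t t0.
  rewrite /Rintegral.
  have -> : (fun x : R => (x <= t)%R%:R%:E) =
      (fun x => (\1_(`]-oo, t]%classic) x)%:E) :> (R -> \bar R).
    by apply/funext => s; rewrite indicE mem_setE in_itv.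
  rewrite integral_indic//; congr (fine (mu _)).
  apply/seteqP; split => s /=; rewrite !in_itv/= le_min.
    by move=> [-> /andP[-> ->]].
  by move=> /andP[-> /andP[-> ->]].
Qed.

(** By the Jordan decomposition both [nu] and its integral are differences of the same two finite
    measures, each of which represents its distribution function. *)
Lemma charge_integral_represents (v : D 0 T)
    (nu : {charge set (measurableTypeR R) -> \bar R}) :
  0 <= T -> is_dv v nu ->
  represents v (charge_integral nu `[0, T]%classic).
Proof.
move=> T0 vnu; rewrite /charge_integral.
set P := cid _; set N := cid _.
apply: eq_represents (representsB (finite_measure_represents _)
  (finite_measure_represents _)) => // t t0T.
have := vnu t t0T; rewrite (jordan_decomp (svalP N))// /cadd/= /cscale mulN1e.
rewrite -[X in (X + _)%E]fineK; last exact: fin_num_measure.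
rewrite -[X in (_ - X)%E]fineK; last exact: fin_num_measure.
by rewrite -EFinB => -[].
Qed.
End representing_functional.

(** * Uniform boundedness *)

Section nested_balls.
Context {R : realType}.
Implicit Types (g : nat -> R -> R) (r : nat -> R).

(** Completeness for the uniform norm: the balls of centre [g k] and radius [r k] are nested with
    radii tending to 0, so a common point exists and is a uniform limit of continuous functions. *)
Lemma nested_balls_limit g r :
  (forall k, continuous (g k)) -> (forall k, r k.+1 <= k.+1%:R^-1) ->
  (forall k t, `|g k.+1 t - g k t| <= r k - r k.+1) -> (forall k, 0 <= r k) ->
  exists2 h : R -> R, continuous h & forall k t, `|h t - g k t| <= r k.
Proof.
move=> cg rinv gr r0.
have grD k j t : `|g (k + j)%N t - g k t| <= r k - r (k + j)%N.
  elim: j => [|j IH]; first by rewrite addn0 !subrr normr0.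
  rewrite addnS (_ : g _ t - _ =
    (g (k + j).+1 t - g (k + j)%N t) + (g (k + j)%N t - g k t)); last by ring.
  by rewrite (le_trans (ler_normD _ _))//; have := gr (k + j)%N t; lra.
have grle i j t : g i t - r i <= g j t + r j.
  have [ij|/ltnW ji] := leqP i j.
    have := grD i (j - i)%N t; rewrite subnKC// ler_norml; have := r0 i; have := r0 j; lra.
  have := grD j (i - j)%N t; rewrite subnKC// ler_norml; have := r0 i; have := r0 j; lra.
(* By [grle] every lower envelope [g i - r i] lies below every upper envelope [g j + r j], so the
   supremum of the former is within [r k] of each [g k]. *)
pose h t := sup (range (fun k => g k t - r k)).
have hg k t : `|h t - g k t| <= r k.
  have ub : has_ubound (range (fun k => g k t - r k)).
    by exists (g k t + r k) => _ [i _ <-].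
  have h1 : g k t - r k <= h t by apply: ub_le_sup => //; exists k.
  have h2 : h t <= g k t + r k.
    by apply: ge_sup => [|_ [i _ <-]//]; exists (g k t - r k), k.
  by rewrite ler_norml; lra.
have tri (a b c d q e : R) : `|a - b| <= q -> `|b - c| < e / 3 ->
    `|d - c| <= q -> q < e / 3 -> `|a - d| < e.
  by rewrite !ltr_norml !ler_norml; lra.
exists h => // t; apply/cvgrPdist_lt => e e0.
have [N _ /(_ N (leqnn _)) /= Ne] := near_infty_natSinv_lt (PosNum (divr_gt0 e0 (ltr0n R 3))).
have /cvgrPdist_lt/(_ (e / 3)) := cg N.+1 t.
rewrite divr_gt0// => /(_ isT); apply: filterS => s gts.
apply: tri (hg N.+1 t) gts (hg N.+1 s) _.
exact: le_lt_trans (rinv N) Ne.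
Qed.

End nested_balls.

Section uniform_boundedness.
Context {R : realType} (T : R).
Variables (u : nat -> R -> R) (L : nat -> (R -> R) -> R).
Hypothesis uL : forall n, represents T (u n) (L n).
Hypothesis Lbnd : forall f, continuous f -> exists B : R, forall n, `|L n f| <= B.

(* Sokal's trick: one of [g + f] and [g - f] has an image of size at least that
   of [f], so no cancellation with [g] need be controlled. *)
Lemma gliding_step (g : R -> R) (r : R) (k : nat) :
  (forall K : R, exists n (f : R -> R),
    [/\ continuous f, forall t : R, `|f t| <= 1 & K < `|L n f|]) ->
  continuous g -> (exists c : R, forall t : R, `|g t| <= c) -> 0 < r ->
  exists (g' : R -> R) (r' : R),
  [/\ [/\ continuous g', exists c : R, forall t : R, `|g' t| <= c & 0 < r'],
      r' <= k.+1%:R^-1, forall t : R, `|g' t - g t| <= r - r' &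
      forall h, continuous h -> (forall t : R, `|h t - g' t| <= r') ->
        exists n, k%:R < `|L n h|].
Proof.
move=> Linf cg [c gc] r0.
(* With this constant the values of [L n] at [g + (r / 2) f] and [g - (r / 2) f] differ by more than
   [2 (k + 1)], so one of them exceeds [k + 1] in size. *)
have [n [f [cf f1 Lf]]] := Linf ((k%:R + 1) * 2 / r).
have bf : bounded_measurable T f by exact: bounded_measurable_continuous.
have bg : bounded_measurable T g by exact: bounded_measurable_continuous.
have [Llin [M LM] _] := uL n.
have [a [ar La]] : exists a, `|a| <= r / 2 /\
    k%:R + 1 < `|L n (fun t => a * f t + g t)|.
  have [Lp|Lp] := ltP (k%:R + 1) `|L n (fun t => r / 2 * f t + g t)|.
    by exists (r / 2); split=> //; rewrite ger0_norm// divr_ge0// ltW.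
  exists (- (r / 2)); split; first by rewrite normrN ger0_norm// divr_ge0// ltW.
  move: Lp; rewrite !Llin//.
  have {}Lf : (k%:R + 1) * 2 < `|r * L n f|.
    by rewrite normrM (gtr0_norm r0) [ltRHS]mulrC -ltr_pdivrMr.
  have : r * L n f = (r / 2 * L n f + L n g) - (- (r / 2) * L n f + L n g).
    by field.
  move: (_ + L n g) (_ + L n g) (r * L n f) Lf => A B C Lf CE.
  rewrite CE in Lf; have := ler_normB B A; lra.
have cg' : continuous (fun t => a * f t + g t).
  move=> t; apply: cvgD; last exact: cg.
  by apply: cvgM; [exact: cvg_cst|exact: cf].
have ag t : `|a * f t + g t - g t| <= r / 2.
  rewrite addrK normrM (le_trans _ ar)//.
  by rewrite ler_piMr// f1.
have g'c : forall t : R, `|a * f t + g t| <= r / 2 + c.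
  move=> t; rewrite -[X in `|X|](subrK (g t)) (le_trans (ler_normD _ _))//.
  by rewrite lerD.
exists (fun t => a * f t + g t),
  (Num.min (r / 2) (Num.min k.+1%:R^-1 (`|M| + 1)^-1)).
have M1 : 0 < `|M| + 1 by rewrite ltr_pwDr.
split.
- split=> //; first by exists (r / 2 + c).
  by rewrite !lt_min divr_gt0// !invr_gt0 ltr0n M1.
- by rewrite !ge_min lexx orbT.
- move=> t; rewrite (le_trans (ag t))// lerBrDl -lerBrDr ge_min.
  by rewrite (_ : r - r / 2 = r / 2) ?lexx//; field.
- move=> h ch hg'; exists n.
  have bh : bounded_measurable T h.
    apply: (bounded_measurable_continuous (c := r / 2 + (r / 2 + c))) => // t _.
    rewrite -[h t](subrK (a * f t + g t)) (le_trans (ler_normD _ _))//.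
    by rewrite lerD// (le_trans (hg' t))// ge_min lexx.
  have bg' := bounded_measurable_lin a bf bg.
  have : `|L n (fun t => -1 * (a * f t + g t) + h t)| <= 1.
    apply: le_trans (LM _ (`|M| + 1)^-1 _ _) _.
    - exact: bounded_measurable_lin.
    - move=> t _; rewrite mulN1r addrC (le_trans (hg' t))//.
      by rewrite !ge_min lexx !orbT.
    - by rewrite ler_pdivrMr// mul1r; have := ler_norm M; lra.
  rewrite Llin//; move: (L n h) (L n _) La => A B.
  by have := ler_normB B (-1 * B + A); rewrite (_ : B - _ = 2 * B - A); last ring;
   have := ler_normD (-1 * B + A) (- A);
   rewrite (_ : -1 * B + A - A = - B); [rewrite !normrN; lra|ring].
Qed.

(** Banach-Steinhaus by a gliding hump: if no [K] worked, iterating [gliding_step] would give a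
    continuous [h] in all the balls, with [|L n h|] above every [k] for some [n], against [Lbnd]. *)
Lemma uniform_boundedness :
  exists K : R, forall n f, continuous f -> (forall t : R, `|f t| <= 1) -> `|L n f| <= K.
Proof.
apply: contrapT => noK.
have Linf (K : R) : exists n (f : R -> R),
    [/\ continuous f, forall t : R, `|f t| <= 1 & K < `|L n f|].
  apply: contrapT => H; apply: noK; exists K => n f cf f1.
  by rewrite leNgt; apply/negP => Kf; apply: H; exists n, f.
pose S := {p : (R -> R) * R | [/\ continuous p.1,
  exists c : R, forall t : R, `|p.1 t| <= c & 0 < p.2]}.
have /choice[F FP] : forall kp : nat * S, exists q : S,
    [/\ (sval q).2 <= kp.1.+1%:R^-1,
     forall t : R, `|(sval q).1 t - (sval kp.2).1 t| <= (sval kp.2).2 - (sval q).2 &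
     forall h, continuous h -> (forall t : R, `|h t - (sval q).1 t| <= (sval q).2) ->
        exists n, kp.1%:R < `|L n h|].
  move=> [k [[g r] /= [cg gc r0]]].
  have [g' [r' [gS ? ? ?]]] := gliding_step k Linf cg gc r0.
  by exists (exist _ (g', r') gS).
have p0P : [/\ continuous (fun _ : R => 0 : R),
    exists c : R, forall t : R, `|0 : R| <= c & (0 : R) < 1].
  by split=> //; [move=> t; exact: cvg_cst|exists 0; rewrite normr0].
pose p := fix p k : S := if k is j.+1 then F (j, p j) else exist _ (fun _ : R => 0, 1) p0P.
have [] := @nested_balls_limit R (fun k => (sval (p k)).1) (fun k => (sval (p k)).2).
- by move=> k; case: (p k) => -[? ?] [].
- by move=> k; have [] := FP (k, p k).
- by move=> k; have [] := FP (k, p k).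
- by move=> k; case: (p k) => -[? ?] [] /= _ _ /ltW.
move=> h ch hp.
have [B LB] := Lbnd ch.
(* Step [k] of the construction concerns the ball [p k.+1]; with [k] equal to [(Num.truncn B).+1],
   above [B], the relevant ball has index [(Num.truncn B).+2]. *)
have [_ _ /(_ h ch (hp (Num.truncn B).+2))[n] /= kL] :=
  FP ((Num.truncn B).+1, p (Num.truncn B).+1).
by have := lt_le_trans kL (LB n); rewrite ltNge (ltW (truncnS_gt B)).
Qed.

End uniform_boundedness.

(** * Ramp functions and step approximation *)

Section ramp.
Context {R : realType}.
Implicit Types s t d : R.

(** For [d > 0], a continuous majorant of the indicator of [s <= t]: 1 up to [t], 0 from [t + d] on,
    affine in between. *)
Definition ramp t d s : R := Num.min 1 (Num.max 0 ((t + d - s) / d)).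

Lemma ramp_continuous t d : continuous (ramp t d).
Proof.
move=> s.
pose g s : R := (t + d - s) / d.
apply: (@continuous_min R R (cst 1) (cst 0 \max g) s); first exact: cvg_cst.
apply: (@continuous_max R R (cst 0) g s); first exact: cvg_cst.
apply: cvgM; last exact: cvg_cst.
by apply: cvgB; [exact: cvg_cst|exact: cvg_id].
Qed.

Lemma ramp_ge0 t d s : 0 <= ramp t d s.
Proof. by rewrite /ramp le_min ler01 le_max lexx. Qed.

Lemma ramp_le1 t d s : ramp t d s <= 1.
Proof. by rewrite /ramp ge_min lexx. Qed.

Lemma ler_ramp t t' d s : 0 < d -> t <= t' -> ramp t d s <= ramp t' d s.
Proof.
move=> d0 tt'; rewrite /ramp le_min ge_min lexx/= ge_min; apply/orP; right.
by rewrite ge_max le_max lexx/= le_max ler_pM2r ?invr_gt0// lerB// ?lerD// orbT.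
Qed.

(** The count [S] exceeds the clamp of [m - y] to [[0, m]] by at most 1; the disjunctions spell out
    the minimum and maximum so that the induction is linear arithmetic. *)
Lemma count_ge_bounds (y : R) m : let S := \sum_(i < m) (y <= i.+1%:R)%R%:R in
  [/\ 0 <= S <= m%:R, (m%:R <= S) || (m%:R - y <= S) &
      (S <= 0) || (S <= m%:R - y + 1)].
Proof.
elim: m => [|m /=]; first by rewrite big_ord0/= !lexx.
rewrite big_ord_recr/= -natr1; move: (\sum_(i < m) _) (m%:R) (ler0n R m) => S n n0.
move=> [/andP[S0 Sn] /orP Sl /orP Su].
have [yn|yn] := leP y (n + 1); rewrite ?addr0 /=; split.
- by apply/andP; split; lra.
- by apply/orP; case: Sl => Sl; [left|right]; lra.
- by apply/orP; right; case: Su => Su; lra.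
- by apply/andP; split; lra.
- by apply/orP; right; lra.
- by apply/orP; left; case: Su => Su; lra.
Qed.

(** A ramp is the average over [q] in [[t, t + d]] of the indicators of [s <= q]; the sum is a
    Riemann sum of this average. *)
Lemma ramp_average t d s m : 0 < d -> (0 < m)%N ->
  `|ramp t d s - \sum_(i < m) m%:R^-1 * (s <= t + d * i.+1%:R / m%:R)%R%:R|
    <= m%:R^-1.
Proof.
move=> d0 m0; rewrite -mulr_sumr.
have m0' : 0 < m%:R :> R by rewrite ltr0n.
(* Affine rescaling that turns the thresholds [t + d * i.+1 / m] into the integers [i.+1]. *)
pose y := m%:R * (s - t) / d.
have -> : \sum_(i < m) (s <= t + d * i.+1%:R / m%:R)%R%:R =
          \sum_(i < m) (y <= i.+1%:R)%R%:R :> R.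
  apply: eq_bigr => i _; congr ((_ : bool)%:R).
  by rewrite /y ler_pdivrMr// -lerBlDl ler_pdivlMr// mulrC (mulrC d).
have -> : ramp t d s = m%:R^-1 * Num.min m%:R (Num.max 0 (m%:R - y)).
  rewrite /ramp minr_pMr ?invr_ge0 ?ler0n// mulVf ?gt_eqF//.
  rewrite maxr_pMr ?invr_ge0 ?ler0n// mulr0; congr (Num.min _ (Num.max _ _)).
  by rewrite /y; field; rewrite !gt_eqF.
rewrite -mulrBr normrM ger0_norm ?invr_ge0 ?ler0n// ler_piMr ?invr_ge0 ?ler0n//.
have [/andP[]] := count_ge_bounds y m.
move: (\sum_(i < m) _) (m%:R : R) m0' => S n n0.
move=> S0 Sn /orP Sl /orP Su; rewrite ler_norml !minEle !maxEle.
apply/andP; case: (leP 0 (n - y)) => ny.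
  by case: (leP n (n - y)) => ny'; split; case: Sl Su => Sl [] Su; lra.
by rewrite (leNgt n 0) n0/=; split; case: Sl Su => Sl [] Su; lra.
Qed.

End ramp.

Section represents_ramp.
Context {R : realType} (T : R) (u : R -> R) (L : (R -> R) -> R).
Hypothesis uL : represents T u L.

Lemma bounded_measurable_ramp t d : bounded_measurable T (ramp t d).
Proof.
apply: (bounded_measurable_continuous (c := 1)); first exact: ramp_continuous.
by move=> s _; rewrite ger0_norm ?ramp_ge0 ?ramp_le1.
Qed.

Lemma represents_sum m (a : nat -> R) (f : nat -> R -> R) :
  (forall i, bounded_measurable T (f i)) ->
  bounded_measurable T (fun s => \sum_(i < m) a i * f i s) /\
  L (fun s => \sum_(i < m) a i * f i s) = \sum_(i < m) a i * L (f i).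
Proof.
move=> bf; have [Llin _ _] := uL; elim: m => [|m [IHb IHL]].
  have b0 : bounded_measurable T (fun=> 0 : R).
    apply: (bounded_measurable_continuous (c := 0)) => [s|s _]; first exact: cvg_cst.
    by rewrite normr0.
  have -> : (fun s => \sum_(i < 0) a i * f i s) = (fun=> 0).
    by apply/funext => s; rewrite big_ord0.
  split=> //; rewrite big_ord0; have := Llin 1 _ _ b0 b0.
  under [X in L X]eq_fun do rewrite mul1r addr0.
  by rewrite mul1r => /eqP; rewrite eq_sym -subr_eq0 addrK => /eqP.
have -> : (fun s => \sum_(i < m.+1) a i * f i s) =
          (fun s => a m * f m s + \sum_(i < m) a i * f i s).
  by apply/funext => s; rewrite big_ord_recr/= addrC.
by rewrite big_ord_recr/= Llin// IHL addrC; split=> //; exact: bounded_measurable_lin.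
Qed.

(** By [ramp_average], [L (ramp t d)] is, up to an error at most [M / m], an average of values of
    [u] on [[t, t + d]], so it stays in any closed interval containing these values. This plays the
    part of an integration by parts. *)
Lemma represents_ramp t d c eta : 0 <= t -> 0 < d ->
  (forall s, t <= s <= t + d -> `|u (Num.min s T) - c| <= eta) ->
  `|L (ramp t d) - c| <= eta.
Proof.
move=> t0 d0 uc; have [Llin [M LM] Lu] := uL.
apply/ler_addgt0Pr => e e0.
have M1 : 0 < `|M| + 1 by rewrite ltr_pwDr.
have [N _ /(_ N (leqnn _)) /= Ne] := near_infty_natSinv_lt (PosNum (divr_gt0 e0 M1)).
pose f i s : R := (s <= t + d * i.+1%:R / N.+1%:R)%R%:R.
have bf i : bounded_measurable T (f i) by exact: bounded_measurable_indic.
have [bA LA] := represents_sum N.+1 (fun=> N.+1%:R^-1) bf.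
set A := (fun s => _) in bA LA.
have {}LA : `|L A - c| <= eta.
  rewrite LA (_ : c = \sum_(i < N.+1) N.+1%:R^-1 * c); last first.
    by rewrite sumr_const card_ord -mulrnAl -[X in X * _]mulr_natl mulfV ?pnatr_eq0// mul1r.
  rewrite -sumrB (le_trans (ler_norm_sum _ _ _))//.
  rewrite (_ : eta = \sum_(i < N.+1) N.+1%:R^-1 * eta); last first.
    by rewrite sumr_const card_ord -mulrnAl -[X in X * _]mulr_natl mulfV ?pnatr_eq0// mul1r.
  apply: ler_sum => i _; rewrite -mulrBr normrM ger0_norm ?invr_ge0//.
  have i0 : 0 <= d * i.+1%:R / N.+1%:R by rewrite divr_ge0// mulr_ge0// ltW.
  rewrite ler_wpM2l ?invr_ge0// /f Lu ?addr_ge0// uc// lerDl i0 lerD2l.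
  by rewrite -mulrA ler_piMr ?(ltW d0)// ler_pdivrMr// mul1r ler_nat.
have : `|L (fun s => -1 * A s + ramp t d s)| <= e.
  apply: le_trans (LM _ (N.+1%:R^-1) _ _) _.
  - by apply: bounded_measurable_lin => //; exact: bounded_measurable_ramp.
  - by move=> s _; rewrite mulN1r addrC; exact: ramp_average.
  - have : N.+1%:R^-1 * (`|M| + 1) < e by rewrite -ltr_pdivlMr.
    move=> /ltW; apply: le_trans; rewrite mulrC ler_wpM2l ?invr_ge0//.
    by have := ler_norm M; lra.
rewrite Llin//; last exact: bounded_measurable_ramp.
move: (L A) (L (ramp t d)) LA => x y xc yx.
rewrite (_ : y - c = (x - c) + (-1 * x + y)); last by ring.
by rewrite (le_trans (ler_normD _ _))// lerD.
Qed.

End represents_ramp.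

(** * Stopping at successive oscillations *)

Section greedy.
Context {R : realType} (T K r : R) (u : R -> R).
Hypothesis uK : forall t : R, 0 <= t <= T -> `|u t| <= K.
Hypothesis ucont : forall t e : R, 0 <= t <= T -> 0 < e ->
  exists2 d : R, 0 < d & forall s, t <= s <= t + d -> `|u (Num.min s T) - u t| <= e.

Lemma greedy_steps N (a : R) : 0 <= a <= T ->
  (exists t : nat -> R, [/\ t 0%N = a, forall i, (i <= N)%N -> 0 <= t i <= T,
     forall i, (i < N)%N -> t i <= t i.+1 &
     forall i, (i < N)%N -> r <= `|u (t i.+1) - u (t i)|]) \/
  (exists c tau : nat -> R, [/\ forall i, a <= tau i <= T,
     forall i, `|c i| <= 2 * K &
     forall s, a <= s <= T ->
       `|u s - u a - \sum_(i < N) c i * (tau i <= s)%R%:R| <= r]).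
Proof.
elim: N a => [|N IH] a a0T.
  by left; exists (fun=> a).
have K0 : 0 <= K by exact: le_trans (normr_ge0 _) (uK a0T).
have [small|] := pselect (forall s, a <= s <= T -> `|u s - u a| <= r).
  right; exists (fun=> 0), (fun=> a); split => [i|i|s asT].
  - by rewrite lexx; case/andP: a0T.
  - by rewrite normr0 mulr_ge0.
  - by rewrite big1 ?subr0 ?small// => i _; rewrite mul0r.
move=> /existsNP[s0 /not_implyP[as0T /negP]]; rewrite -ltNge => s0r.
case/andP: a0T => a0 aT; case/andP: as0T => as0 s0T.
pose S := [set s | a <= s <= T /\ r < `|u s - u a|].
have Ss0 : S s0 by split=> //; rewrite as0.
have lbS : lbound S a by move=> s [/andP[]].
pose tau := inf S.
have infS : has_inf S by split; [exists s0|exists a].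
have atau : a <= tau by apply: lb_le_inf => //; exists s0.
have tauS s : S s -> tau <= s by move=> Ss; apply: ge_inf => //; exists a.
have tauT : tau <= T := le_trans (tauS _ Ss0) s0T.
have tau0T : 0 <= tau <= T by rewrite (le_trans a0 atau).
have before s : a <= s < tau -> `|u s - u a| <= r.
  move=> /andP[as_ stau]; rewrite leNgt; apply/negP => us.
  have : tau <= s by apply: tauS; split=> //; rewrite as_ (le_trans (ltW stau)).
  by rewrite leNgt stau.
(* The infimum [tau] may fail to lie in [S], but points of [S] approach it from the right or equal
   it, and right continuity preserves the inequality in the weak sense. *)
have jump : r <= `|u tau - u a|.
  apply/ler_addgt0Pr => e e0; have [d d0 ud] := ucont tau0T e0.
  have [s Ss sd] := inf_adherent d0 infS.
  have := ud s; rewrite tauS// ltW// => /(_ isT).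
  case: Ss => /andP[_ sT] us; rewrite min_l// => use.
  rewrite (le_trans (ltW us))// (_ : u s - u a = (u tau - u a) + (u s - u tau)); last by ring.
  by rewrite (le_trans (ler_normD _ _))// lerD.
have [[t [t0 t0T tmono tr]]|[c [tau' [tauT' cK app]]]] := IH tau tau0T.
  left; exists (fun i => if i is j.+1 then t j else a); split=> //.
  - by case=> [_|i iN]; [rewrite a0|exact: t0T].
  - by case=> [_|i iN]; [rewrite t0|exact: tmono].
  - by case=> [_|i iN]; [rewrite t0|exact: tr].
right; exists (fun i => if i is j.+1 then c j else u tau - u a),
              (fun i => if i is j.+1 then tau' j else tau); split.
- case=> [|i]; first by rewrite atau.
  by have /andP[? ->] := tauT' i; rewrite andbT (le_trans atau).
- case=> [|i]; last exact: cK.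
  rewrite (le_trans (ler_normB _ _))// mulr_natl mulr2n lerD// uK//.
  by rewrite a0.
- move=> s /andP[as_ sT]; rewrite big_ord_recl/=.
  have [taus|stau] := leP tau s.
    rewrite mulr1 opprD addrA (_ : u s - u a - (u tau - u a) = u s - u tau); last by ring.
    by apply: app; rewrite taus.
  (* Before [tau] no jump has occurred yet, since all later jump times are at least [tau]. *)
  rewrite mulr0 add0r big1 ?subr0 ?before ?as_// => i _.
  rewrite (lt_geF (lt_le_trans stau _)) ?mulr0//.
  by have /andP[] := tauT' i.
Qed.

End greedy.

Section variation_bound.
Context {R : realType} (T K : R) (u : R -> R) (L : (R -> R) -> R).
Hypothesis uL : represents T u L.
Hypothesis ucvg : forall t : R, 0 <= t < T -> u x @[x --> t^'+] --> u t.
Hypothesis LK : forall f, continuous f -> (forall t : R, `|f t| <= 1) -> `|L f| <= K.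

Lemma right_modulus (t e : R) : 0 <= t <= T -> 0 < e ->
  exists2 d : R, 0 < d & forall s, t <= s <= t + d -> `|u (Num.min s T) - u t| <= e.
Proof.
move=> /andP[t0 tT] e0; have [{}tT|Tt] := ltP t T; last first.
  exists 1 => // s /andP[ts _]; rewrite min_r ?(le_trans Tt)//.
  by rewrite (_ : T = t) ?subrr ?normr0 ?ltW//; apply/le_anti; rewrite Tt.
have /cvgrPdist_le/(_ e e0) : u x @[x --> t^'+] --> u t by apply: ucvg; rewrite t0.
move=> [d /= d0 du]; exists (Num.min (d / 2) (T - t)).
  by rewrite lt_min divr_gt0// subr_gt0.
move=> s /andP[ts]; rewrite -lerBlDl le_min => /andP[sd sT].
rewrite min_l; last by move: sT; rewrite lerD2r.
move: ts; rewrite le_eqVlt => /predU1P[->|ts]; first by rewrite subrr normr0 ltW.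
rewrite distrC; apply: du => //=.
by rewrite distrC ger0_norm ?subr_ge0 ?ltW// (le_lt_trans sd)// ltr_pdivrMr// ltr_pMr// ltr1n.
Qed.

Lemma represents_ramp_cvg t : 0 <= t <= T -> L (ramp t d) @[d --> 0^'+] --> u t.
Proof.
move=> t0T; apply/cvgrPdist_le => e e0; have [d d0 du] := right_modulus t0T e0.
near=> x.
have x0 : 0 < x by near: x; exact: nbhs_right_gt.
have xd : x <= d by near: x; exact: nbhs_right_le.
rewrite distrC; apply: (represents_ramp uL) => //; first by case/andP: t0T.
by move=> s /andP[ts sx]; apply: du; rewrite ts (le_trans sx)// lerD2l.
Unshelve. all: by end_near.
Qed.

Lemma norm_ramp_le1 t d s : `|ramp t d s : R| <= 1.
Proof. by rewrite ger0_norm ?ramp_ge0 ?ramp_le1. Qed.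

Lemma represents_norm_le (t : R) : 0 <= t <= T -> `|u t| <= K.
Proof.
move=> t0T; apply: cvgr_to_le (cvg_norm (represents_ramp_cvg t0T)) _.
near=> d; apply: LK; first exact: ramp_continuous.
by move=> s; exact: norm_ramp_le1.
Unshelve. all: by end_near.
Qed.

(** The total variation is bounded by duality: with [sg i] the signs of the increments, the sum is
    the limit as [d] tends to [0^'+] of [L] at a combination of ramps of uniform norm at most 1. *)
Lemma increments_le N (t : nat -> R) : (forall i, (i <= N)%N -> 0 <= t i <= T) ->
  (forall i, (i < N)%N -> t i <= t i.+1) ->
  \sum_(i < N) `|u (t i.+1) - u (t i)| <= K.
Proof.
move=> t0T tmono; have [Llin _ _] := uL.
pose sg i := Num.sg (u (t i.+1) - u (t i)).
have cv : \sum_(i < N) sg i * (L (ramp (t i.+1) d) - L (ramp (t i) d)) @[d --> 0^'+]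
    --> \sum_(i < N) `|u (t i.+1) - u (t i)|.
  have -> : \sum_(i < N) `|u (t i.+1) - u (t i)| =
            \sum_(i < N) sg i * (u (t i.+1) - u (t i)).
    by apply: eq_bigr => i _; rewrite normrEsg.
  apply: cvg_big => [|i _]; first exact: add_continuous.
   apply: cvgMl_tmp; apply: cvgB.
    by apply: represents_ramp_cvg; apply: t0T.
  by apply: represents_ramp_cvg; apply: t0T; exact: ltnW.
apply: cvgr_to_le cv _; near=> d.
have d0 : 0 < d by near: d; exact: nbhs_right_gt.
pose f i s := -1 * ramp (t i) d s + ramp (t i.+1) d s.
have bf i : bounded_measurable T (f i).
  by apply: bounded_measurable_lin; exact: bounded_measurable_ramp.
have [_ Lf] := represents_sum uL N sg bf.
under eq_bigr => i _.
  rewrite (_ : L _ - _ = L (f i)); last first.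
    by rewrite Llin; [rewrite mulN1r addrC| |]; try exact: bounded_measurable_ramp.
  over.
rewrite -Lf (le_trans (ler_norm _))//; apply: LK.
  apply: continuous_big => [|i _ s]; first exact: add_continuous.
  apply: cvgMl_tmp; apply: cvgD; last exact: ramp_continuous.
  by apply: cvgMl_tmp; exact: ramp_continuous.
move=> s; rewrite (le_trans (ler_norm_sum _ _ _))//.
(* Ramps increase with [t], so the absolute values drop and the sum telescopes to a difference of
   two numbers in [[0, 1]]. *)
apply: (@le_trans _ _ (\sum_(i < N) (ramp (t i.+1) d s - ramp (t i) d s))).
  apply: ler_sum => i _; rewrite /f mulN1r addrC normrM.
  rewrite (ger0_norm (_ : 0 <= _ - _)) ?subr_ge0 ?ler_ramp ?tmono//.
  rewrite ler_piMl ?subr_ge0 ?ler_ramp ?tmono//.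
  by rewrite /sg normr_sg; case: (_ == _).
rewrite -(big_mkord xpredT (fun i => ramp (t i.+1) d s - ramp (t i) d s)).
rewrite (telescope_sumr (fun i => ramp (t i) d s))//.
by have := ramp_ge0 (t 0%N) d s; have := ramp_le1 (t N) d s; lra.
Unshelve. all: by end_near.
Qed.

(** [N] stops would produce increments adding up to at least [N * r], above the variation bound [K].
    The additional jump, of size [u 0] at time 0, supplies the initial value. *)
Lemma step_approximation (r : R) N : 0 <= T -> K < N%:R * r ->
  exists c tau : nat -> R, [/\ forall i, 0 <= tau i <= T,
     forall i, `|c i| <= 2 * K &
     forall s, 0 <= s <= T ->
       `|u s - \sum_(i < N.+1) c i * (tau i <= s)%R%:R| <= r].
Proof.
move=> T0 KN; have z0T : 0 <= (0 : R) <= T by rewrite lexx.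
have K0 : 0 <= K := le_trans (normr_ge0 _) (represents_norm_le z0T).
have [[t [_ t0T tmono tr]]|[c [tau [tau0T cK app]]]] :=
  @greedy_steps _ T K r u represents_norm_le right_modulus N 0 z0T.
  have : N%:R * r <= K.
    apply: le_trans (increments_le t0T tmono).
    rewrite mulr_natl -[X in _ *+ X]card_ord -sumr_const.
    by apply: ler_sum => i _; exact: tr.
  by rewrite leNgt KN.
exists (fun i => if i is j.+1 then c j else u 0),
       (fun i => if i is j.+1 then tau j else 0); split.
- by case.
- case=> [|i]; last exact: cK.
  by rewrite (le_trans (represents_norm_le z0T))// ler_peMl// ler1n.
- move=> s s0T; rewrite big_ord_recl/= (_ : 0 <= s = true) ?mulr1.
    by rewrite opprD addrA; exact: app.
  by case/andP: s0T.
Qed.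

End variation_bound.

(** * Jumps in the mJ1 topology *)

Section tent.
Context {R : realType} (a b e : R).
Hypothesis e0 : 0 < e.
Implicit Types p q s t : R.

Definition tent p t : R := Num.min ((t - a) / (p - a)) ((b - t) / (b - p)).

(** The piecewise affine time change that fixes [a] and [b] and sends [p] to [q]. The margin [e]
    between [p] and the endpoints bounds the slopes of the tent by [1 / e]. *)
Definition tent_shift p q t : R := t + (q - p) * tent p t.

Lemma tentEl p t : a + e <= p <= b - e -> t <= p -> tent p t = (t - a) / (p - a).
Proof.
have eps0 := e0; move=> /andP[ap pb] tp; rewrite /tent min_l//.
have pa0 : 0 < p - a by lra.
have bp0 : 0 < b - p by lra.
apply: (@le_trans _ _ 1); first by rewrite ler_pdivrMr// mul1r; lra.
by rewrite ler_pdivlMr// mul1r; lra.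
Qed.

Lemma tentEr p t : a + e <= p <= b - e -> p <= t -> tent p t = (b - t) / (b - p).
Proof.
have eps0 := e0; move=> /andP[ap pb] tp; rewrite /tent min_r//.
have pa0 : 0 < p - a by lra.
have bp0 : 0 < b - p by lra.
apply: (@le_trans _ _ 1); first by rewrite ler_pdivrMr// mul1r; lra.
by rewrite ler_pdivlMr// mul1r; lra.
Qed.

Lemma tent_lipschitz p s t : a + e <= p <= b - e -> s <= t ->
  `|tent p t - tent p s| <= (t - s) / e.
Proof.
have eps0 := e0; move=> pab st; have /andP[ap pb] := pab.
have pa0 : 0 < p - a by lra.
have bp0 : 0 < b - p by lra.
have L1 : (t - s) / (p - a) <= (t - s) / e.
  by rewrite ler_wpM2l ?subr_ge0// lef_pV2 ?posrE//; lra.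
have L2 : (t - s) / (b - p) <= (t - s) / e.
  by rewrite ler_wpM2l ?subr_ge0// lef_pV2 ?posrE//; lra.
have P1 : 0 <= (t - s) / (p - a) by apply: divr_ge0; lra.
have P2 : 0 <= (t - s) / (b - p) by apply: divr_ge0; lra.
rewrite /tent.
have E1 : (t - a) / (p - a) = (s - a) / (p - a) + (t - s) / (p - a).
  by rewrite -mulrDl; congr (_ / _); ring.
have E2 : (b - t) / (b - p) = (b - s) / (b - p) - (t - s) / (b - p).
  by rewrite -mulrBl; congr (_ / _); ring.
rewrite E1 E2 ler_norml; move: L1 L2 P1 P2.
move: ((t - s) / (p - a)) ((t - s) / (b - p)) ((t - s) / e) => x y z.
move: ((s - a) / (p - a)) ((b - s) / (b - p)) => c d xz yz x0 y0.
case: (leP (c + x) (d - y)) => h1; case: (leP c d) => h2; apply/andP; split; lra.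
Qed.

Lemma tent_shift_continuous p q : continuous (tent_shift p q).
Proof.
have eps0 := e0; move=> t; apply: cvgD; first exact: cvg_id.
apply: cvgMl_tmp.
pose f t : R := (t - a) / (p - a); pose g t : R := (b - t) / (b - p).
apply: (@continuous_min R R f g t).
  by apply: cvgM; [apply: cvgB; [exact: cvg_id|exact: cvg_cst]|exact: cvg_cst].
by apply: cvgM; [apply: cvgB; [exact: cvg_cst|exact: cvg_id]|exact: cvg_cst].
Qed.

Lemma tent_shift_slope p q s t : a + e <= p <= b - e -> s < t ->
  `|(tent_shift p q t - tent_shift p q s) / (t - s) - 1| <= `|q - p| / e.
Proof.
have eps0 := e0; move=> pab st; have ts0 : 0 < t - s by rewrite subr_gt0.
rewrite /tent_shift (_ : _ / _ - 1 = (q - p) * ((tent p t - tent p s) / (t - s))); last first.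
  by field; rewrite gt_eqF.
rewrite normrM ler_wpM2l// normrM normfV (gtr0_norm ts0) ler_pdivrMr// mulrC.
by apply: tent_lipschitz => //; exact: ltW.
Qed.

Lemma tent_shift_mono p q s t : a + e <= p <= b - e -> `|q - p| < e -> s < t ->
  tent_shift p q s < tent_shift p q t.
Proof.
have eps0 := e0; move=> pab qp st; have ts0 : 0 < t - s by rewrite subr_gt0.
have := tent_shift_slope q pab st.
have : `|q - p| / e < 1 by rewrite ltr_pdivrMr// mul1r.
move=> /[swap] /le_lt_trans /[apply]; rewrite ltr_norml => /andP[+ _].
by rewrite -subr_gt0 opprK subrK pmulr_lgt0 ?invr_gt0// subr_gt0.
Qed.

Lemma tent_shift_le p q s t : a + e <= p <= b - e -> `|q - p| < e -> s <= t ->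
  tent_shift p q s <= tent_shift p q t.
Proof.
move=> pab qp; rewrite le_eqVlt => /predU1P[->//|st].
by rewrite ltW// tent_shift_mono.
Qed.

Lemma tent_shiftp p q : a + e <= p <= b - e -> tent_shift p q p = q.
Proof.
move=> pab; have eps0 := e0; rewrite /tent_shift tentEl// divff; first by ring.
by case/andP: pab => *; rewrite gt_eqF//; lra.
Qed.

Lemma tent_shiftK p q : a + e <= p <= b - e -> a + e <= q <= b - e ->
  `|q - p| < e -> cancel (tent_shift p q) (tent_shift q p).
Proof.
have eps0 := e0; move=> pab qab qp t.
have [ap pb] := andP pab; have [aq qb] := andP qab.
have pa0 : 0 < p - a by lra.
have bp0 : 0 < b - p by lra.
have qa0 : 0 < q - a by lra.
have bq0 : 0 < b - q by lra.
(* The shift carries the tent at [p] to the tent at [q], so the two displacements are opposite. *)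
suff E : tent q (tent_shift p q t) = tent p t by rewrite {1}/tent_shift E /tent_shift; ring.
have [tp|/ltW pt] := leP t p.
  have le_q : tent_shift p q t <= q.
    by rewrite -{2}(tent_shiftp q pab) tent_shift_le.
  by rewrite tentEl// tentEl// /tent_shift tentEl//; field; rewrite !gt_eqF.
have le_q : q <= tent_shift p q t.
  by rewrite -{1}(tent_shiftp q pab) tent_shift_le.
by rewrite tentEr// tentEr// /tent_shift tentEr//; field; rewrite !gt_eqF.
Qed.

Lemma tent_shift_endpoints p q : a + e <= p <= b - e ->
  tent_shift p q a = a /\ tent_shift p q b = b.
Proof.
have eps0 := e0; move=> pab; have [ap pb] := andP pab.
by rewrite /tent_shift tentEl ?tentEr//; [rewrite !subrr !mul0r !mulr0 !addr0|lra|lra].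
Qed.

Lemma tent_shift_homeo p q : a + e <= p <= b - e -> a + e <= q <= b - e ->
  `|q - p| < e -> increasing_homeo a b (tent_shift p q).
Proof.
move=> pab qab qp; have pq : `|p - q| < e by rewrite distrC.
have maps x y : a + e <= x <= b - e -> `|y - x| < e ->
    set_fun `[a, b] `[a, b] (tent_shift x y).
  move=> xab yx t /=; rewrite !in_itv/= => /andP[at_ tb].
  have [<- <-] := tent_shift_endpoints y xab.
  by rewrite !tent_shift_le.
split; first by move=> s t _ _; exact: tent_shift_mono.
exists (tent_shift q p); split; [split|split].
- exact: maps.
- exact: maps.
- by move=> t _; exact: tent_shiftK.
- by move=> t _; exact: tent_shiftK.
- exact/continuous_subspaceT/tent_shift_continuous.
- exact/continuous_subspaceT/tent_shift_continuous.
Qed.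

(** All slopes are within [|q - p| / e] of 1, and [ln] is continuous at 1; hence [d] does not depend
    on [p]. *)
Lemma log_slope_tent_shift (rho : R) : 0 < rho -> exists2 d : R, 0 < d &
  forall p q, a + e <= p <= b - e -> `|q - p| < d ->
    (log_slope a b (tent_shift p q) <= rho%:E)%E.
Proof.
move=> rho0.
have /cvgrPdist_lt/(_ rho rho0) : {for 1, continuous (@ln R)} by exact: continuous_ln.
rewrite ln1 => -[d /= d0 lnd].
exists (e * d); first by rewrite mulr_gt0.
move=> p q pab qp; apply: ge_ereal_sup => _ [[s t] /= [as_ st tb] <-].
rewrite lee_fin -normrN -[- _]add0r ltW// lnd//= distrC.
by rewrite (le_lt_trans (tent_shift_slope q pab st))// ltr_pdivrMr// mulrC.
Qed.

End tent.

(** * Heaviside functions and their mJ1 distance *)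

Section heaviside.
Context {R : realType} (T : R).
Implicit Types s t : R.

Definition heaviside_fun s t : R := [&& 0 <= t, s <= t & t <= T]%:R.

Lemma heaviside_subproof s : heaviside_fun s \in Dpred 0 T.
Proof.
apply/DpredP; split; last first.
  move=> t; rewrite /heaviside_fun; case: (0 <= t); case: (t <= T) => //=.
  by rewrite andbF.
split=> t /andP[t1 t2].
  apply: cvg_near_cst; have [st|ts] := leP s t; near=> x; rewrite /heaviside_fun.
    have tx : t < x by near: x; exact: nbhs_right_gt.
    have xT : x < T by near: x; exact: nbhs_right_lt.
    by rewrite t1 (ltW t2) (le_trans t1 (ltW tx)) (ltW xT) st (le_trans st (ltW tx)).
  have xs : x < s by near: x; exact: nbhs_right_lt.
  by rewrite (lt_geF xs) (lt_geF ts) !andbF.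
apply/cvg_ex; exists (s < t)%R%:R; apply: cvg_near_cst.
have [st|ts] := ltP s t; near=> x; rewrite /heaviside_fun;
  have xt : x < t by near: x; exact: nbhs_left_lt.
  have x0 : 0 < x by near: x; exact: nbhs_left_gt.
  have sx : s < x by near: x; exact: nbhs_left_gt.
  by rewrite (ltW x0) (le_trans (ltW xt) t2) (ltW sx).
by rewrite (lt_geF (lt_le_trans xt ts)) andbF.
Unshelve. all: by end_near.
Qed.

Definition heaviside s : D 0 T := MkD (heaviside_subproof s).

Lemma heavisideE s t : 0 <= t <= T -> heaviside s t = (s <= t)%R%:R.
Proof. by case/andP=> t0 tT; rewrite /= /heaviside_fun t0 tT andbT. Qed.

End heaviside.

Section mJ1_distance.
Context {R : realType} (T eps : R).
Hypotheses (T0 : 0 < T) (eps0 : 0 < eps).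

Lemma ext_heaviside s t : 0 <= s <= T -> ext T (heaviside T s) t = (s <= t)%R%:R.
Proof.
move=> /andP[s0 sT]; rewrite /ext; have [t0|t0] := ltP t 0.
  by rewrite lt_geF// (lt_le_trans t0).
have [tT|Tt] := ltP t T; first by rewrite heavisideE// t0 ltW.
by rewrite heavisideE ?sT ?(le_trans sT)// lexx ltW.
Qed.

(** The time change sending [p] to [q] matches the two extended functions exactly, so only its log
    slope counts. The extension by [eps] on both sides makes jumps at 0 and at [T] interior, hence
    movable. *)
Lemma mJ1_dist_heaviside (p : R) (rho : R) : 0 <= p <= T -> 0 < rho ->
  exists2 d : R, 0 < d & forall q : R, 0 <= q <= T -> `|q - p| < d ->
    (mJ1_dist eps (heaviside T p) (heaviside T q) < rho%:E)%E.
Proof.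
move=> p0T rho0; have hrho0 : 0 < rho / 2 by rewrite divr_gt0.
have inner q : 0 <= q <= T -> - eps + eps <= q <= T + eps - eps.
  by rewrite addNr addrK.
have [d d0 dP] := @log_slope_tent_shift R (- eps) (T + eps) eps eps0 _ hrho0.
exists (Num.min d eps); first by rewrite lt_min d0.
move=> q q0T; rewrite lt_min => /andP[qd qe].
apply: (@le_lt_trans _ _ (rho / 2)%:E); last by rewrite lte_fin; lra.
apply: ge_ereal_inf; eexists; first exists (tent_shift (- eps) (T + eps) p q) => //.
  exact: (tent_shift_homeo eps0 (inner _ p0T) (inner _ q0T)).
rewrite ge_max dP ?inner//=; apply: ge_ereal_sup => _ [t _ <-].
rewrite !ext_heaviside//.
have -> : (q <= tent_shift (- eps) (T + eps) p q t) = (p <= t).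
  rewrite -{1}(tent_shiftp eps0 q (inner _ p0T)).
  have [pt|tp] := leP p t; first by rewrite (tent_shift_le eps0 (inner _ p0T)).
  by rewrite lt_geF// (tent_shift_mono eps0 (inner _ p0T)).
by rewrite subrr normr0 lee_fin ltW.
Qed.

Lemma mJ1_dist_le_sup (x y : D 0 T) (rho : R) : 0 <= rho ->
  (forall t : R, 0 <= t <= T -> `|x t - y t| <= rho) ->
  (mJ1_dist eps x y <= rho%:E)%E.
Proof.
move=> rho0 xy.
have inner : - eps + eps <= 0 <= T + eps - eps by rewrite addNr addrK lexx ltW.
(* The identity time change, written as a trivial shift so that [tent_shift_homeo] applies. *)
have shift_id t : tent_shift (- eps) (T + eps) 0 0 t = t by rewrite /tent_shift; ring.
apply: ge_ereal_inf; eexists; first exists (tent_shift (- eps) (T + eps) 0 0) => //.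
  by apply: (tent_shift_homeo eps0 inner inner); rewrite subrr normr0.
rewrite ge_max; apply/andP; split; apply: ge_ereal_sup.
  move=> _ [[s t] /= [_ st _] <-].
  by rewrite !shift_id divff ?gt_eqF ?subr_gt0// ln1 normr0 lee_fin.
move=> _ [t _ <-]; rewrite shift_id lee_fin /ext.
have [t0|t0] := ltP t 0; first by rewrite subrr normr0.
have [tT|Tt] := ltP t T; first by rewrite xy// t0 ltW.
by rewrite xy// lexx ltW.
Qed.

End mJ1_distance.

(** * Linear topologies coarser than mJ1 *)

(** A cluster point along an ultrafilter is a limit. One ultrafilter then serves all coordinates at
    once, in place of successive extractions of subsequences. *)
Lemma ultra_cvg_compact (I : Type) (F : set_system I) (X : topologicalType)
    (A : set X) (f : I -> X) :
  UltraFilter F -> compact A -> (forall i, A (f i)) ->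
  exists2 p, A p & f i @[i --> F] --> p.
Proof.
move=> UF cA fA; have [p [Ap clp]] : A `&` cluster (f @ F) !=set0.
  by apply: cA; exact: nearW.
exists p => // B pB; have [//|FB] := in_ultra_setVsetC (f @^-1` B) UF.
have [x [+ Bx]] : (~` B) `&` B !=set0 by apply: clp.
by [].
Qed.

(** Jump times tending to [s] may lie on either side of it, so the test is made on an interval
    [[s1, b]] just right of [s]. There the step functions are eventually constant, with value
    tending to that of the limit step function at [s], while the ramp integrals tend to 0. *)
Lemma limit_steps_small (R : realType) (T r : R) (F : set_system nat)
    (u : nat -> R -> R) (L : nat -> (R -> R) -> R) (N : nat)
    (c tau : nat -> nat -> R) (c0 tau0 : nat -> R) :
  ProperFilter F -> 0 <= T -> (forall n, represents T (u n) (L n)) ->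
  (forall t d, L n (ramp t d) @[n --> F] --> 0) ->
  (forall n i, 0 <= tau n i <= T) ->
  (forall n s, 0 <= s <= T ->
    `|u n s - \sum_(i < N) c n i * (tau n i <= s)%R%:R| <= r) ->
  (forall i, c n i @[n --> F] --> c0 i) ->
  (forall i, tau n i @[n --> F] --> tau0 i) ->
  forall s, 0 <= s <= T -> `|\sum_(i < N) c0 i * (tau0 i <= s)%R%:R| <= r.
Proof.
move=> FF T0 uL L0 tau0T app cc0 tautau0 s /andP[s0 sT].
have [b [sb bP]] : exists b, s < b /\ forall i : 'I_N, s < tau0 i -> b < tau0 i.
  apply: (@filter_ex _ (s^'+) _ (fun b => s < b /\ forall i : 'I_N, s < tau0 i -> b < tau0 i)).
  near=> b; split; first by near: b; exact: nbhs_right_gt.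
  near: b; apply: filter_forall => i.
  by have [?|?] := ltP s (tau0 i); near=> b => //; near: b; exact: nbhs_right_lt.
pose s1 := (s + b) / 2.
have ss1 : s < s1 by rewrite /s1; lra.
have s1b : s1 < b by rewrite /s1; lra.
have stable : \forall n \near F, forall i : 'I_N, forall q, s1 <= q <= b ->
    (tau n i <= q) = (tau0 i <= s).
  apply: filter_forall => i; have [tis|tis] := leP (tau0 i) s.
    have : \forall n \near F, tau n i < s1.
      by apply: cvgr_lt (tautau0 i) _ _; exact: le_lt_trans ss1.
    apply: filterS => n tn q /andP[s1q _].
    by rewrite ltW// (lt_le_trans tn).
  have : \forall n \near F, b < tau n i.
    by apply: cvgr_gt (tautau0 i) _ _; exact: bP.
  apply: filterS => n tn q /andP[_ qb].
  by rewrite lt_geF// (le_lt_trans qb).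
have cvd : L n (ramp s1 (b - s1)) - \sum_(i < N) c n i * (tau0 i <= s)%R%:R
    @[n --> F] --> 0 - \sum_(i < N) c0 i * (tau0 i <= s)%R%:R.
  apply: cvgB; first exact: L0.
  apply: cvg_big => [|i _]; first exact: add_continuous.
  by apply: cvgMr_tmp; exact: cc0.
rewrite -normrN -[- _]add0r; apply: cvgr_to_le (cvg_norm cvd) _.
apply: filterS stable => n tn; apply: (represents_ramp (uL n)).
- by rewrite ltW// (le_lt_trans s0).
- by rewrite subr_gt0.
- move=> q /andP[s1q]; rewrite addrC subrK => qb.
  have qT : 0 <= Num.min q T <= T.
    by rewrite le_min T0 ge_min lexx orbT !andbT (le_trans _ s1q)// ltW// (le_lt_trans s0).
  have := app n _ qT; congr (`|_ - _| <= r); apply: eq_bigr => i _.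
  (* All jump times are at most [T], so clamping [q] at [T] does not change which jumps have
     occurred. *)
  congr (_ * (_ : bool)%:R); rewrite -(tn i q) ?s1q// le_min.
  by have /andP[_ ->] := tau0T n i; rewrite andbT.
Unshelve. all: by end_near.
Qed.

Section linear_topology_coarser_than_mJ1.
Context {R : realType} (T eps : R) (T0 : 0 < T) (eps0 : 0 < eps).
Variable sigma : Topological (D 0 T).
Hypothesis linear_sigma : linear_topology sigma.
Hypothesis sigma_mJ1 : coarser sigma (mJ1_topology T eps).
Let Et : topologicalType := Topological.Pack sigma.

Lemma nbhs_mJ1_ball (x : D 0 T) (A : set (D 0 T)) : @nbhs _ Et x A ->
  exists2 r : R, 0 < r & forall y, (mJ1_dist eps x y < r%:E)%E -> A y.
Proof.
rewrite nbhsE => -[B [oB Bx] BA].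
have [r r0 rB] := sigma_mJ1 oB Bx.
by exists r => // y /rB /BA.
Qed.

Lemma heaviside_cvg (I : Type) (F : set_system I) (p : I -> R) (q : R) :
  Filter F -> (forall i, 0 <= p i <= T) -> 0 <= q <= T ->
  p i @[i --> F] --> q -> (heaviside T (p i) : Et) @[i --> F] --> (heaviside T q : Et).
Proof.
move=> FF p0T q0T pq A /nbhs_mJ1_ball[r r0 rA].
have [d d0 dP] := mJ1_dist_heaviside T0 eps0 q0T r0.
have /cvgrPdist_lt/(_ d d0) := pq.
by apply: filterS => i qpi; apply: rA; apply: dP => //; rewrite distrC.
Qed.

(** Coefficients and jump times move together, which calls for joint continuity of the scaling; the
    number [N] of terms is fixed. *)
Lemma steps_cvg (I : Type) (F : set_system I) N (c tau : I -> nat -> R)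
    (c0 tau0 : nat -> R) :
  Filter F -> (forall i k, 0 <= tau i k <= T) -> (forall k, 0 <= tau0 k <= T) ->
  (forall k, c i k @[i --> F] --> c0 k) ->
  (forall k, tau i k @[i --> F] --> tau0 k) ->
  (\sum_(k < N) c i k *: heaviside T (tau i k) : Et) @[i --> F] -->
  (\sum_(k < N) c0 k *: heaviside T (tau0 k) : Et).
Proof.
move=> FF tauT tau0T cc0 tautau0; have [addc scalec] := linear_sigma.
apply: (@cvg_big Et 'I_N (@GRing.add (D 0 T)) 0 xpredT addc) => k _.
apply: (@continuous2_cvg _ R^o Et Et F _ _ _ (fun a (x : D 0 T) => a *: x : Et)).
- exact: (scalec (c0 k, heaviside T (tau0 k) : Et)).
- exact: cc0.
- exact: heaviside_cvg.
Qed.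

End linear_topology_coarser_than_mJ1.

(** * Comparison with the S topology *)

Lemma supnorm_le (R : realType) (a b e : R) (f : R -> R) :
  (supnorm a b f <= e%:E)%E -> forall t : R, a <= t <= b -> `|f t| <= e.
Proof.
move=> fe t tab; rewrite -lee_fin (le_trans _ fe)//.
by apply: ereal_sup_ubound; exists t => //=; rewrite in_itv.
Qed.

Lemma D_sumE (R : realType) (T : R) N (a : nat -> R) (x : nat -> D 0 T) (t : R) :
  (\sum_(i < N) a i *: x i : D 0 T) t = \sum_(i < N) a i * x i t.
Proof.
elim: N => [|N IH]; first by rewrite !big_ord0.
by rewrite !big_ord_recr/= -IH.
Qed.

Theorem theorem4p7 (R : realType) (T eps : R) (T_gt0 : 0 < T) (eps_gt0 : 0 < eps)
    (sigma : Topological (D 0 T)) :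
  linear_topology sigma ->
  coarser sigma (mJ1_topology T eps) ->
  coarser sigma (S_topology T).
Proof.
move=> lin cmJ1 U oU; rewrite S_openE => x x0 nUx xx0 Ux0.
have T0 := ltW T_gt0.
pose Et : topologicalType := Topological.Pack sigma.
have [addc _] := lin.
have Unbhs : @nbhs _ Et (x0 + 0 : D 0 T) U.
  by rewrite addr0; exact: (@open_nbhs_nbhs Et).
(* [A] will receive a family converging to [x0], and [B] the uniformly small remainder. *)
have [[A B] /= [Ax0 B0] ABU] := addc (x0 : Et, 0 : Et) U Unbhs.
have [rho rho0 rhoB] := nbhs_mJ1_ball cmJ1 B0.
(* The remainder consists of four errors of size at most [r], namely [x n - v n], [x0 - v0],
   [u n - step n] and [y]; their total [rho / 2] is strictly below [rho]. *)
pose r := rho / 8.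
have r0 : 0 < r by rewrite divr_gt0.
have [v [v0 [_ xv xv0 [nu [nu0 [vnu v0nu0 cvnu]]]]]] := xx0 r r0.
pose u n (t : R) := v n t - v0 t.
pose L n (f : R -> R) := charge_integral (nu n) `[0, T]%classic f -
              charge_integral nu0 `[0, T]%classic f.
have uL n : represents T (u n) (L n).
  by apply: representsB; exact: charge_integral_represents.
have Lcvg f : continuous f -> L n f @[n --> \oo] --> 0.
  move=> cf; rewrite -[X in _ --> X](subrr (charge_integral nu0 `[0, T]%classic f)).
  by apply: cvgB; [apply: cvnu; exact: continuous_subspaceT|exact: cvg_cst].
have [K LK] : exists K : R, forall n f, continuous f ->
    (forall t : R, `|f t| <= 1) -> `|L n f| <= K.
  apply: (uniform_boundedness uL) => f /Lcvg cf.
  have /cvg_seq_bounded[M [_ LM]] : cvgn (fun n => L n f : R^o).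
    by apply/cvg_ex; exists 0.
  by exists (M + 1) => n; apply: LM => //; rewrite ltrDl.
have ucvg n t : 0 <= t < T -> u n x @[x --> t^'+] --> u n t.
  move=> tT; have cad (y : D 0 T) : y x @[x --> t^'+] --> y t.
    by have /DpredP[[/(_ t tT)]] := valP y.
  by apply: cvgB; exact: cad.
pose N := (Num.truncn (K / r)).+1.
have KN : K < N%:R * r by rewrite -ltr_pdivrMr//; exact: truncnS_gt.
have /choice[ct /all_and3[ctT ctK ctapp]] : forall n, exists ct : (nat -> R) * (nat -> R),
    [/\ forall i, 0 <= ct.2 i <= T, forall i, `|ct.1 i| <= 2 * K &
     forall s, 0 <= s <= T ->
       `|u n s - \sum_(i < N.+1) ct.1 i * (ct.2 i <= s)%R%:R| <= r].
  move=> n; have [c [tau H]] := step_approximation (uL n) (ucvg n) (LK n) T0 KN.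
  by exists (c, tau).
(* [F] refines the filter of tails, so limits of sequences persist along it. *)
have [F [UF ooF]] := ultraFilterLemma (@eventually_filter).
have /choice[c0 c0P] : forall i, exists l : R, (ct n).1 i @[n --> F] --> l.
  move=> i; have [|l _] := ultra_cvg_compact UF (@segment_compact R (- (2 * K)) (2 * K))
    (f := fun n => (ct n).1 i).
    by move=> n /=; rewrite in_itv/= -ler_norml.
  by exists l.
have /choice[tau0 /all_and2[tau0T tau0P]] : forall i, exists l : R,
    0 <= l <= T /\ (ct n).2 i @[n --> F] --> l.
  move=> i; have [|l lT] := ultra_cvg_compact UF (@segment_compact R 0 T)
    (f := fun n => (ct n).2 i).
    by move=> n /=; rewrite in_itv/=.
  by exists l; split=> //; move: lT; rewrite /= in_itv.
pose step n : D 0 T := \sum_(i < N.+1) (ct n).1 i *: heaviside T ((ct n).2 i).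
pose y : D 0 T := \sum_(i < N.+1) c0 i *: heaviside T (tau0 i).
have stepE n s : 0 <= s <= T ->
    step n s = \sum_(i < N.+1) (ct n).1 i * ((ct n).2 i <= s)%R%:R.
  move=> sT; rewrite /step (D_sumE _ _ (fun i => heaviside T ((ct n).2 i))).
  by apply: eq_bigr => i _; rewrite heavisideE.
have y_small s : 0 <= s <= T -> `|y s| <= r.
  move=> sT; rewrite /y (D_sumE _ _ (fun i => heaviside T (tau0 i))).
  under eq_bigr do rewrite heavisideE//.
  apply: (limit_steps_small _ T0 uL _ (fun n => ctT n) _ c0P tau0P) => // t d.
  by apply: cvg_trans (Lcvg _ (@ramp_continuous R t d)); exact: cvg_app.
have stepA : \forall n \near F, A (step n + (x0 - y)).
  have : (step n + (x0 - y) : Et) @[n --> F] --> (y + (x0 - y) : Et).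
    apply: (@continuous2_cvg _ Et Et Et F _ _ _ (fun a b : D 0 T => a + b : Et)).
    - exact: (addc (y : Et, x0 - y : Et)).
    - exact: (steps_cvg T_gt0 eps_gt0 lin cmJ1 (c := fun n => (ct n).1)
        (tau := fun n => (ct n).2) _ ctT tau0T c0P tau0P).
    - exact: cvg_cst.
  by apply; rewrite addrC subrK.
(* One index is enough for the contradiction, since every [x n] lies outside [U]. *)
have [n An] := filter_ex stepA.
apply: (nUx n).
have -> : x n = (step n + (x0 - y)) + (x n - (step n + (x0 - y))) by rewrite addrC subrK.
apply: (ABU (_, _)); split=> //=; apply: rhoB.
apply: (@le_lt_trans _ _ (rho / 2)%:E); last by rewrite lte_fin; lra.
apply: mJ1_dist_le_sup => // [|t tT]; first by rewrite divr_ge0// ltW.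
have h1 := supnorm_le (xv n) tT.
have h2 := supnorm_le xv0 tT.
have h3 := y_small t tT.
have h4 := ctapp n t tT; rewrite -stepE// in h4.
move: h1 h2 h3 h4; rewrite /u /r.
have -> : (x n - v n : D 0 T) t = x n t - v n t by [].
have -> : (x0 - v0 : D 0 T) t = x0 t - v0 t by [].
have -> : (x n - (step n + (x0 - y)) : D 0 T) t = x n t - (step n t + (x0 t - y t)) by [].
have -> : (0 : D 0 T) t = 0 by [].
move: (x n t) (v n t) (x0 t) (v0 t) (y t) (step n t) => a b c d e f.
rewrite !ler_norml => /andP[? ?] /andP[? ?] /andP[? ?] /andP[? ?].
by apply/andP; split; lra.
Qed.
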